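(* Let $p$ be a prime with $p\equiv 1\pmod 4$. Then $\mathrm{NC}^9_{12p}$ is a connected cubic non-symmetric vertex-transitive non-Cayley graph of order $12p$, and $\mathrm{Aut}(\mathrm{NC}^9_{12p})\cong (S_3\times\mathbb{Z}_p)\rtimes\mathbb{Z}_4$.
   Context: For a group $H$ and subsets $R,L,S\subseteq H$ with $R=R^{-1}$, $L=L^{-1}$ and $1\notin R\cup L$, the bi-Cayley graph $\mathrm{BiCay}(H,R,L,S)$ has vertex set $\{h_0:h\in H\}\cup\{h_1:h\in H\}$ and edges $\{h_0,g_0\}$ for $gh^{-1}\in R$, $\{h_1,g_1\}$ for $gh^{-1}\in L$, and $\{h_0,g_1\}$ for $gh^{-1}\in S$. For $p\equiv1\pmod 4$ prime, let $\lambda$ be an element of order $4$ in $\mathbb{Z}_p^*$, let $H=\langle a,b\mid a^2=b^2=(ab)^3=1\rangle\times\langle c\rangle\cong S_3\times\mathbb{Z}_p$ with $c$ of order $p$, and set $\mathrm{NC}^9_{12p}=\mathrm{BiCay}(H,\{ac,ac^{-1}\},\{bc^{\lambda},bc^{-\lambda}\},\{1\})$. A graph is vertex-transitive if its automorphism group is transitive on vertices, symmetric if it is transitive on arcs, and Cayley if its automorphism group contains a subgroup acting regularly on the vertex set. *)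

(* Defs.v *)
From HB Require Import structures.
From mathcomp Require Import all_boot all_order all_algebra.
From mathcomp Require Import all_fingroup all_solvable.

Set Implicit Arguments.
Unset Strict Implicit.
Unset Printing Implicit Defensive.

Local Open Scope group_scope.

(* A finite simple graph is a symmetric irreflexive relation on its finite    *)
(* type of vertices.                                                          *)
Section Graphs.

Variables (V : finType) (e : rel V).

Definition simple_graph : Prop := symmetric e /\ irreflexive e.

Definition connected_graph : Prop := forall x y : V, connect e x y.

Definition cubic : Prop := forall x : V, #|[set y | e x y]| = 3.

Definition graph_aut : {set {perm V}} :=
  [set s : {perm V} | [forall x, forall y, e (s x) (s y) == e x y]].

Lemma graph_autP (s : {perm V}) :
  reflect (forall x y, e (s x) (s y) = e x y) (s \in graph_aut).
Proof.
rewrite inE; apply: (iffP forallP) => [H x y | H x].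
  by apply/eqP; move/forallP: (H x).
by apply/forallP => y; rewrite H.
Qed.

Lemma graph_aut_group_set : group_set graph_aut.
Proof.
apply/group_setP; split=> [|s t /graph_autP hs /graph_autP ht].
  by apply/graph_autP => x y; rewrite !perm1.
by apply/graph_autP => x y; rewrite !permM ht hs.
Qed.

Canonical graph_aut_group := Group graph_aut_group_set.

Definition vertex_transitive : Prop :=
  [transitive graph_aut, on [set: V] | 'P].

Definition arc_transitive : Prop :=
  forall x y u v : V, e x y -> e u v ->
    exists2 s : {perm V}, s \in graph_aut & s x = u /\ s y = v.

Definition regular_action (G : {group {perm V}}) : Prop :=
  [transitive G, on [set: V] | 'P] /\ forall x : V, 'C_G[x | 'P] = 1.

Definition is_Cayley : Prop :=
  exists2 G : {group {perm V}}, G \subset graph_aut & regular_action G.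

End Graphs.

(* The vertex h_0 is (h, false) and the vertex h_1 is (h, true).              *)
Definition BiCay (gT : finGroupType) (R L S : {set gT}) : rel (gT * bool) :=
  fun u v => match u, v with
    | (h, false), (g, false) => g * h^-1 \in R
    | (h, true), (g, true) => g * h^-1 \in L
    | (h, false), (g, true) => g * h^-1 \in S
    | (g, true), (h, false) => g * h^-1 \in S
    end.

Lemma BiCay_simple (gT : finGroupType) (R L S : {set gT}) :
    R^-1 = R -> L^-1 = L -> 1 \notin R :|: L ->
  simple_graph (BiCay R L S).
Proof.
move=> RV LV; rewrite inE negb_or => /andP[R1 L1]; split.
  by case=> h [] [g []] //=; rewrite -[_ * _]invgK invMg invgK -mem_invg ?RV ?LV.
by case=> h [] /=; rewrite mulgV; apply: negbTE.
Qed.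

(* S_3 x Z_p with its direct product group structure. The group law of 'Z_p   *)
(* is addition, so Zp1 is a generator of order p.                             *)
Definition S3Zp (p : nat) : finGroupType := ('S_3 * 'Z_p)%type.

Section NC9.

Variable p : nat.

Definition s3a : 'S_3 := tperm (inord 0) (inord 1).
Definition s3b : 'S_3 := tperm (inord 1) (inord 2).

Definition genA : S3Zp p := (s3a, 1).
Definition genB : S3Zp p := (s3b, 1).
Definition genC : S3Zp p := (1, Zp1).

Definition NC9_R : {set S3Zp p} := [set genA * genC; genA * genC^-1].

(* Powers of genC are taken with the representative of lambda in 0, ..., p-1. *)
Definition NC9_L (lambda : {unit 'Z_p}) : {set S3Zp p} :=
  let l : nat := (val lambda : 'Z_p) in
  [set genB * genC ^+ l; genB * genC ^- l].

Definition NC9 (lambda : {unit 'Z_p}) : rel (S3Zp p * bool) :=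
  BiCay NC9_R (NC9_L lambda) [set 1].

(* genA, genB and genC realise the presentation                               *)
(* < a, b | a^2 = b^2 = (ab)^3 = 1 > x < c >, with c of order p.              *)

Lemma card_S3Zp : 1 < p -> #|S3Zp p| = (6 * p)%N.
Proof. by move=> p1; rewrite card_prod card_Sn card_ord Zp_cast. Qed.

Lemma genA2 : genA ^+ 2 = 1.
Proof. by rewrite expgS expg1; congr pair; rewrite /= ?tperm2 ?mulg1. Qed.

Lemma genB2 : genB ^+ 2 = 1.
Proof. by rewrite expgS expg1; congr pair; rewrite /= ?tperm2 ?mulg1. Qed.

Lemma s3ab3 : (s3a * s3b) ^+ 3 = 1.
Proof.
rewrite /s3a /s3b; set i0 := inord 0; set i1 := inord 1; set i2 := inord 2.
have d10 : i1 != i0 by rewrite -val_eqE /= !inordK.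
have d20 : i2 != i0 by rewrite -val_eqE /= !inordK.
have d02 : i0 != i2 by rewrite eq_sym.
have d12 : i1 != i2 by rewrite -val_eqE /= !inordK.
have f0 : (tperm i0 i1 * tperm i1 i2) i0 = i2 by rewrite permM !tpermL.
have f1 : (tperm i0 i1 * tperm i1 i2) i1 = i0.
  by rewrite permM tpermR tpermD.
have f2 : (tperm i0 i1 * tperm i1 i2) i2 = i1.
  by rewrite permM (tpermD d02 d12) tpermR.
rewrite !expgS expg0 mulg1; apply/permP => x; rewrite perm1 !(permM (_ * _)).
have: x \in [:: i0; i1; i2].
  by rewrite !inE -!val_eqE /= !inordK //; case: x => -[|[|[]]].
by rewrite !inE => /or3P[] /eqP->; rewrite ?(f0, f1, f2).
Qed.

Lemma genAB3 : (genA * genB) ^+ 3 = 1.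
Proof.
have -> : genA * genB = @pairg1 'S_3 ('Z_p) (s3a * s3b) by congr pair; rewrite mulg1.
by rewrite -morphX ?inE // s3ab3.
Qed.

Lemma order_genC : 1 < p -> #[genC] = p.
Proof.
move=> p1; have -> : genC = @pair1g 'S_3 ('Z_p) Zp1 by [].
by rewrite order_injm ?injm_pair1g ?inE // order_Zp1 Zp_cast.
Qed.

Lemma gen_s3ab : <<[set s3a; s3b]>> = [set: 'S_3].
Proof.
have oa : #[s3a] = 2.
  apply: nt_prime_order => //; first by rewrite expgS expg1 tperm2.
  by apply/eqP => /permP/(_ (inord 0)); rewrite perm1 tpermL => /(congr1 val);
     rewrite /= !inordK.
have oab : #[s3a * s3b] = 3.
  apply: nt_prime_order => //; first exact: s3ab3.
  apply/eqP => /permP/(_ (inord 0)); rewrite perm1 permM !tpermL.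
  by move=> /(congr1 val); rewrite /= !inordK.
apply/eqP; rewrite eqEcard subsetT /= cardsT card_Sn.
have := @order_dvdG _ <<[set s3a; s3b]>> s3a; rewrite oa => da.
have := @order_dvdG _ <<[set s3a; s3b]>> (s3a * s3b); rewrite oab => dab.
apply: dvdn_leq => //; rewrite -[3`!]/(2 * 3)%N Gauss_dvd //.
by rewrite da ?dab ?groupM ?mem_gen ?inE ?eqxx ?orbT.
Qed.

Lemma gen_AB : <<[set genA; genB]>> = setX [set: 'S_3] 1 :> {set S3Zp p}.
Proof.
rewrite -morphim_pairg1 -[X in _ @* X]gen_s3ab morphim_gen ?subsetT //.
by rewrite morphimEsub ?subsetT // imsetU !imset_set1.
Qed.

Lemma gen_AB_presentation :
  <<[set genA; genB]>> \isog Grp (x : y : x ^+ 2, y ^+ 2, (x * y) ^+ 3).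
Proof.
have oG : #|<<[set genA; genB]>>| = 6 by rewrite gen_AB cardsX cardsT card_Sn cards1.
have [a1 b1 ab] : [/\ genA != 1, genB != 1 & genA != genB].
  split; apply/eqP => /(congr1 fst) /permP/(_ (inord 1)) /=;
  by rewrite ?perm1 ?tpermL ?tpermR => /(congr1 val); rewrite /= !inordK.
have oa : #[genA] = 2 by apply: nt_prime_order; rewrite ?genA2.
have ob : #[genB] = 2 by apply: nt_prime_order; rewrite ?genB2.
have /= iso := involutions_gen_dihedral oa ob ab; rewrite oG in iso.
move=> rT H; rewrite -(@Grp'_dihedral 3 isT).
exact: (eq_homgr _ iso).
Qed.

Lemma S3Zp_dprod : <<[set genA; genB]>> \x <[genC]> = [set: S3Zp p].
Proof.
have -> : <[genC]> = setX 1 [set: 'Z_p] :> {set S3Zp p}.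
  rewrite -morphim_pair1g [X in _ @* X]Zp_cycle morphim_cycle ?inE //.
rewrite gen_AB setX_dprod.
by apply/setP => -[x y]; rewrite !inE.
Qed.

Lemma NC9_simple (lambda : {unit 'Z_p}) : simple_graph (NC9 lambda).
Proof.
have CA : commute genA genC by congr pair; rewrite /= ?mulg1 ?mul1g.
have CB n : commute genB (genC ^+ n).
  by apply: commuteX; congr pair; rewrite /= ?mulg1 ?mul1g.
have AV : genA^-1 = genA by apply/eqP; rewrite eq_invg_mul -(expgS _ 1) genA2.
have BV : genB^-1 = genB by apply/eqP; rewrite eq_invg_mul -(expgS _ 1) genB2.
have TV (x y : S3Zp p) : x^-1 = x -> commute x y ->
    [set x * y; x * y^-1]^-1 = [set x * y; x * y^-1].
  move=> xV cxy; rewrite invUg !invg_set1 !invMg invgK xV setUC.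
  by rewrite cxy (commuteV cxy).
have fst1 (s : 'S_3) (k : S3Zp p) : s != 1 -> k.1 = 1 ->
    (1 == ((s, 1) : S3Zp p) * k) = false.
  by move=> s1 k1; apply/negP => /eqP/(congr1 fst)/= /esym/eqP;
     rewrite k1 mulg1 (negbTE s1).
have a1 : s3a != 1.
  by apply/eqP => /permP/(_ (inord 0)); rewrite perm1 tpermL => /(congr1 val);
     rewrite /= !inordK.
have b1 : s3b != 1.
  by apply/eqP => /permP/(_ (inord 1)); rewrite perm1 tpermL => /(congr1 val);
     rewrite /= !inordK.
have C1 n : (genC ^+ n).1 = 1 by elim: n => //= n; rewrite expgS /= mul1g.
apply: BiCay_simple; rewrite ?TV //.
by rewrite !inE !fst1 //= ?C1 ?invg1.
Qed.

End NC9.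

(* Main.v *)
Require Import Defs.
From mathcomp Require Import all_boot all_order all_algebra.
From mathcomp Require Import all_fingroup all_solvable.
From mathcomp Require Import ring.

(** The right translations by H and the map [alpha : h_i |-> theta(h)_(1-i)],
    where [theta] exchanges a and b and sends c to c^lambda, generate a
    vertex-transitive group (S_3 x Z_p) : Z_4 of automorphisms.

    Every automorphism preserves the perfect matching of spokes {h_0, h_1}: the
    number of closed non-backtracking walks of length 10 with a prescribed first
    arc is 8 for a spoke and 6 for the other arcs (24 and 22 if p = 5). Indeed,
    a walk returns iff its S_3-component is trivial and its Z_p-component
    m + n lambda vanishes; the latter forces p to divide m^2 + n^2, which for
    walks of this length only happens for m = n = 0 when p > 5.

    An automorphism that fixes a vertex and a rim neighbour of it is trivial:
    its fixed vertices spread along the rim cycles and across the spokes. Hence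
    the stabiliser of 1_0 is {1, alpha^2} and the group above is everything. A
    regular subgroup would contain alpha or alpha^-1, hence the nontrivial
    element alpha^2, which fixes 1_0. *)

Set Implicit Arguments.
Unset Strict Implicit.
Unset Printing Implicit Defensive.

Import GRing.Theory.
Local Open Scope ring_scope.

(** * Counting non-backtracking walks *)

(* The walks counted begin with the arc (x, y) and have k further steps. *)
Fixpoint nb_walks (V : finType) (e : rel V) (k : nat) (x y t : V) : nat :=
  if k is k'.+1 then
    (\sum_(z | e y z && (z != x)) nb_walks e k' y z t)%N
  else (y == t : nat).

Lemma nb_walks_aut (V : finType) (e : rel V) (f : {perm V}) k x y t :
  f \in graph_aut e ->
  nb_walks e k (f x) (f y) (f t) = nb_walks e k x y t.
Proof.
move/graph_autP=> fe; elim: k x y => [|k IH] x y /=.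
  by rewrite (inj_eq perm_inj).
rewrite (reindex_inj (@perm_inj _ f)) /=.
by apply: eq_big => z; rewrite ?fe ?(inj_eq perm_inj).
Qed.

(** * Formal walks and their computation *)

(* The edges at a vertex are labelled by [None] (spoke) and by [Some false] and
   [Some true] (the rim edges along which the Z_p-component is increased,
   respectively decreased). *)
Definition label := option bool.

(** A step [None] is undone by [None] and [Some b] by [Some (~~ b)]; the labels listed are those
    that do not backtrack. *)
Definition next_labels (l : label) : seq label :=
  if l is Some b then [:: None; Some b] else [:: Some false; Some true].

(* A state records a vertex ((s, m + n lambda), i), with s : 'S_3 given by the
   images of 0, 1 and 2, so that it can be computed with. *)
Definition state := ((nat * nat * nat) * (int * int) * bool)%type.

Definition sgn (b : bool) : int := if b then -1 else 1.

Definition advance (st : state) (l : label) : state :=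
  let: ((x, y, z), (m, n), i) := st in
  if l is Some b then
    if i then ((x, z, y), (m, n + sgn b), i) else ((y, x, z), (m + sgn b, n), i)
  else ((x, y, z), (m, n), ~~ i).

Fixpoint sym_walks (k : nat) (l : label) (st : state) : seq state :=
  if k is k'.+1 then
    flatten [seq sym_walks k' l' (advance st l') | l' <- next_labels l]
  else [:: st].

Definition start (i : bool) : state := ((0%N, 1%N, 2%N), (0, 0), i).

(** The first arc and 9 further steps make length 10. The [Z_p]-component stays formal, so that one
    computation serves all primes. *)
Definition returns (i : bool) (l : label) : seq (int * int) :=
  [seq st.1.2 | st <- sym_walks 9 l (advance (start i) l) &
     (st.1.1 == (0%N, 1%N, 2%N)) && (st.2 == i)].

Definition sqnorm (v : int * int) : int := v.1 ^+ 2 + v.2 ^+ 2.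

(* If 5 < p and p = 1 mod 4, then p does not divide the squared norm of a
   nonzero harmless vector. *)
Definition harmless (v : int * int) : bool :=
  (v == (0, 0)) ||
  (sqnorm v != 0) &&
  all (fun q => (q %% 4 == 1)%N ==> (q == 5)%N) (primes `|sqnorm v|%N).

Lemma returns_harmless i l : all harmless (returns i l).
Proof. by case: i l => [] [[]|]; vm_compute. Qed.

Lemma returns_zero i l :
  count (pred1 (0, 0)) (returns i l) = (if l is Some _ then 6 else 8)%N.
Proof. by case: i l => [] [[]|]; vm_compute. Qed.

(** The residues 2 and 3 are the elements of order 4 modulo 5. *)
Lemma returns_five i l c : c \in [:: 2%N; 3%N] ->
  count (fun v => (5 %| v.1 + c%:Z * v.2)%Z) (returns i l) =
    (if l is Some _ then 22 else 24)%N.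
Proof. by rewrite !inE => /orP[] /eqP->; case: i l => [] [[]|]; vm_compute. Qed.

Lemma mem_perm_cons (T : eqType) (x : T) (s t : seq T) w :
  perm_eq t (x :: s) -> uniq t -> (w \in t) && (w != x) = (w \in s).
Proof.
move=> ts; rewrite (perm_uniq ts) (perm_mem ts) inE => /= /andP[/negbTE xs _].
by case: (eqVneq w x) => [->|_] /=; rewrite ?xs ?andbT.
Qed.

(** * Arithmetic of [lambda] modulo [p] *)

Section Graph.

Variables (p : nat) (lambda : {unit 'Z_p}).
Hypotheses (p_prime : prime p) (p_mod4 : p = 1 %[mod 4]).
Hypothesis lambda_order : #[lambda]%g = 4.

Let p_gt1 : (1 < p)%N := prime_gt1 p_prime.

Lemma p_ge5 : (5 <= p)%N.
Proof. by case: p p_prime p_mod4 => [|[|[|[|[|n]]]]]. Qed.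

Lemma pcharZp : p \in [pchar 'Z_p].
Proof. by rewrite inE p_prime /= pchar_Zp. Qed.

Local Notation lam := (val lambda : 'Z_p).
Let l : nat := lam.

Lemma lam_nat : lam = l%:Z%:~R.
Proof. by rewrite -pmulrn natr_Zp. Qed.

Lemma lamX n : val (lambda ^+ n)%g = lam ^+ n.
Proof. by rewrite FinRing.val_unitX. Qed.

Lemma lam4 : lam ^+ 4 = 1.
Proof.
by rewrite -lamX; have := expg_order lambda; rewrite lambda_order => ->.
Qed.

Lemma lam2_neq1 : lam ^+ 2 != 1.
Proof.
rewrite -lamX -[1]/(val (1%g : {unit 'Z_p})) (inj_eq val_inj).
by rewrite -order_dvdn lambda_order.
Qed.

Lemma lam_unit : lam \is a GRing.unit.
Proof. exact: valP. Qed.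

Lemma Zp_intr0 (n : int) : (n%:~R == 0 :> 'Z_p) = (p %| n)%Z.
Proof. by rewrite -(dvdz_pcharf pcharZp). Qed.

(** The prime [p] divides [(l^2 - 1)(l^2 + 1)], and order 4 excludes the first factor. *)
Lemma lam2 : lam ^+ 2 = -1.
Proof.
have /eqP: (l%:Z ^+ 4 - 1)%:~R = 0 :> 'Z_p.
  by rewrite rmorphB rmorphXn /= -lam_nat lam4 subrr.
rewrite Zp_intr0 (_ : _ - 1 = (l%:Z ^+ 2 - 1) * (l%:Z ^+ 2 + 1)); last by ring.
rewrite dvdzE abszM Euclid_dvdM // => /orP[] D; last first.
  apply/eqP; rewrite -addr_eq0.
  have: (p %| l%:Z ^+ 2 + 1)%Z by [].
  by rewrite -Zp_intr0 rmorphD rmorphXn /= -lam_nat.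
case/eqP: lam2_neq1; apply/eqP; rewrite -subr_eq0.
have: (p %| l%:Z ^+ 2 - 1)%Z by [].
by rewrite -Zp_intr0 rmorphB rmorphXn /= -lam_nat.
Qed.

Lemma dvd_sqnorm (v : int * int) :
  (p %| v.1 + l%:Z * v.2)%Z -> (p %| sqnorm v)%Z.
Proof.
rewrite -!Zp_intr0 /sqnorm !rmorphD !rmorphXn rmorphM /= -lam_nat addr_eq0.
by move/eqP->; rewrite sqrrN exprMn lam2 mulN1r addNr.
Qed.

Lemma count_returns i lb :
  count (fun v => (p %| v.1 + l%:Z * v.2)%Z) (returns i lb) =
    ((if p == 5 then 22 else 6) + (lb == None).*2)%N.
Proof.
have [p5|p5] := eqVneq p 5%N.
  have l23 : l \in [:: 2%N; 3%N].
    have lt5 : (l < 5)%N.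
      by apply: leq_trans (ltn_ord lam) _; rewrite Zp_cast // p5.
    have : (5 %| l ^ 2 + 1)%N.
      have : (p %| (l ^ 2 + 1)%:Z)%Z.
        rewrite -Zp_intr0 PoszD rmorphD /= -pmulrn natrX pmulrn -lam_nat.
        by rewrite lam2 addNr.
      by rewrite dvdzE p5.
    by case: l lt5 => [|[|[|[|[|n]]]]].
  by rewrite p5 returns_five //; case: lb.
(* For [p] other than 5 only zero vectors vanish: otherwise [p] would be a forbidden prime factor of
   the squared norm of a harmless vector. *)
rewrite (_ : count _ _ = count (pred1 (0, 0)) (returns i lb)); last first.
  apply: eq_in_count => v /(allP (returns_harmless i lb)) /=.
  rewrite /harmless; case: eqVneq => [->|] /=; first by rewrite mulr0 dvdz0.
  move=> _ /andP[nz /allP H].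
  apply/negP => /dvd_sqnorm; rewrite dvdzE /= => D.
  have := H p; rewrite mem_primes p_prime D absz_gt0 nz p_mod4 (negbTE p5) /=.
  by move/(_ isT).
by rewrite returns_zero; case: lb.
Qed.

(** * Adjacency in coordinates *)

Local Notation V := (S3Zp p * bool)%type.
Local Notation e := (NC9 lambda).

Definition gen (i : bool) : 'S_3 := if i then s3b else s3a.
Definition stride (i : bool) : 'Z_p := if i then lam else 1.

Definition nbr (v : V) (lb : label) : V :=
  let: ((s, z), i) := v in
  if lb is Some b then (((gen i * s)%g, z + (sgn b)%:~R * stride i), i)
  else ((s, z), ~~ i).

Lemma genCX n : (genC p ^+ n)%g = (1%g, n%:R : 'Z_p) :> S3Zp p.
Proof.
elim: n => [|n IH]; first by [].
rewrite expgS IH /genC; congr pair; rewrite /= ?mulg1 //.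
by rewrite FinRing.zmodMgE -natr1 addrC.
Qed.

Lemma mem_pair_edge (s t u : 'S_3) (z z' c : 'Z_p) :
  ((((t, z') : S3Zp p) * ((s, z) : S3Zp p)^-1)%g
     \in [set ((u, c) : S3Zp p); (u, - c)]) =
  (t == (u * s)%g) && ((z' == z + c) || (z' == z - c)).
Proof.
have -> : (((t, z') : S3Zp p) * ((s, z) : S3Zp p)^-1)%g =
    ((t * s^-1)%g, z' - z) by [].
rewrite !inE !xpair_eqE -(inj_eq (mulIg s)) mulgKV !subr_eq.
by rewrite ![_ + z]addrC -andb_orr.
Qed.

Lemma NC9_RE : NC9_R p = [set (s3a, 1); (s3a, -1)].
Proof.
rewrite /NC9_R /genA /genC.
by congr [set _; _]; congr pair;
   rewrite /= ?invg1 ?mulg1 // FinRing.zmodMgE add0r.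
Qed.

Lemma NC9_LE : NC9_L lambda = [set (s3b, lam); (s3b, - lam)].
Proof.
rewrite /NC9_L genCX natr_Zp.
by congr [set _; _]; congr pair;
   rewrite /= ?invg1 ?mulg1 // FinRing.zmodMgE add0r.
Qed.

Lemma NC9E (v w : V) :
  e v w = (w \in [:: nbr v None; nbr v (Some false); nbr v (Some true)]).
Proof.
have spoke (x y : S3Zp p) : ((x * y^-1)%g \in [set 1%g]) = (x == y).
  by rewrite inE -eq_mulgV1.
case: v w => [[s z] i] [[t z'] j]; rewrite /NC9 NC9_RE NC9_LE !inE !xpair_eqE.
by case: i j => [] [] /=; rewrite ?mem_pair_edge ?spoke ?xpair_eqE ?andbF ?andbT
     ?orbF ?mul1r ?mulN1r ?mulr1 -?andb_orr // ![_ == s]eq_sym ![_ == z]eq_sym.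
Qed.

Lemma stride_unit i : stride i \is a GRing.unit.
Proof. by case: i; rewrite ?lam_unit ?unitr1. Qed.

(** As [p >= 5], [k] is nonzero modulo [p], and the stride is a unit. This separates vertices up to
    four steps apart on a rim. *)
Lemma natr_stride_eq0 k i : (0 < k < 5)%N -> (k%:R * stride i == 0) = false.
Proof.
case/andP=> k0 k5; rewrite -(mul0r (stride i)) (inj_eq (mulIr (stride_unit i))).
by rewrite pmulrn Zp_intr0 dvdzE gtnNdvd //= (leq_trans k5 p_ge5).
Qed.

Lemma nbr_uniq v : uniq [:: nbr v None; nbr v (Some false); nbr v (Some true)].
Proof.
case: v => [[s z] i] /=; rewrite !inE !xpair_eqE !eqxx /=.
rewrite (inj_eq (addrI z)) mul1r mulN1r -[stride i == _]addr_eq0 -mulr2n.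
rewrite -mulr_natl.
by rewrite natr_stride_eq0 //; case: i; rewrite /= ?andbF.
Qed.

Lemma edgeP v w : reflect (exists lb, w = nbr v lb) (e v w).
Proof.
rewrite NC9E !inE; apply: (iffP or3P) => [[] /eqP->|].
- by exists None.
- by exists (Some false).
- by exists (Some true).
by case=> -[[]|] ->; [apply: Or33 | apply: Or32 | apply: Or31].
Qed.

Definition rev_label (lb : label) : label := omap negb lb.

Lemma gen2 i : (gen i * gen i = 1)%g.
Proof. by case: i; apply: tperm2. Qed.

Lemma nbrK v lb : nbr (nbr v lb) (rev_label lb) = v.
Proof.
case: v lb => [[s z] i] [b|] /=; last by rewrite negbK.
rewrite mulgA gen2 mul1g -addrA -mulrDl -rmorphD.
by rewrite (_ : sgn b + sgn (~~ b) = 0) ?mul0r ?addr0 //; case: b.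
Qed.

Definition nbr_except (v : V) (lb : label) : seq V :=
  [seq nbr v lb' | lb' <- next_labels lb].

(** The edge back to [v] has label [rev_label lb]; removing it from the three labels leaves
    [next_labels lb]. *)
Lemma edge_except v lb w :
  e (nbr v lb) w && (w != v) = (w \in nbr_except (nbr v lb) lb).
Proof.
rewrite -{2}(nbrK v lb) NC9E; have := nbr_uniq (nbr v lb).
move: (nbr v lb) => y; rewrite /nbr_except.
case: lb => [[]|] U; apply: mem_perm_cons U => //.
- exact/permPl/(perm_catCA [:: _] [:: _] [:: _]).
- exact/permPl/(perm_catC [:: _; _] [:: _]).
Qed.

Lemma uniq_nbr_except v lb : uniq (nbr_except v lb).
Proof.
have : subseq (next_labels lb) [:: None; Some false; Some true].
  by case: lb => [[]|].
by move/(map_subseq (nbr v))/subseq_uniq; apply; apply: nbr_uniq.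
Qed.

Lemma nb_walksS k v lb t :
  nb_walks e k.+1 v (nbr v lb) t =
  (\sum_(lb' <- next_labels lb)
     nb_walks e k (nbr v lb) (nbr (nbr v lb) lb') t)%N.
Proof.
rewrite /= (eq_bigl (mem (nbr_except (nbr v lb) lb))); last first.
  by move=> w; rewrite edge_except.
by rewrite -big_uniq ?uniq_nbr_except //= big_map.
Qed.

(** * Formal walks as walks of the graph *)

Definition images (s : 'S_3) : nat * nat * nat :=
  (s (inord 0) : nat, s (inord 1) : nat, s (inord 2) : nat).

Definition tracks (st : state) (v : V) : Prop :=
  [/\ st.1.1 = images v.1.1,
      v.1.2 = st.1.2.1%:~R + lam * st.1.2.2%:~R & st.2 = v.2].

Lemma ord3_neq : [/\ inord 0 != inord 1 :> 'I_3, inord 0 != inord 2 :> 'I_3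
  & inord 1 != inord 2 :> 'I_3].
Proof. by split; rewrite -val_eqE /= !inordK. Qed.

(** Products act from left to right, so left multiplication by a transposition permutes the
    positions of the images, not their values. *)
Lemma images_a s : images (s3a * s)%g =
  let: (x, y, z) := images s in (y, x, z).
Proof.
have [n01 n02 n12] := ord3_neq.
by rewrite /images !permM tpermL tpermR tpermD.
Qed.

Lemma images_b s : images (s3b * s)%g =
  let: (x, y, z) := images s in (x, z, y).
Proof.
have [n01 n02 n12] := ord3_neq.
by rewrite /images !permM tpermL tpermR tpermD // eq_sym.
Qed.

Lemma images1 s : (images s == (0, 1, 2)%N) = (s == 1%g).
Proof.
apply/eqP/eqP => [[s0 s1 s2]|->]; last by rewrite /images !perm1 !inordK.
apply/permP => x; rewrite perm1; apply: ord_inj.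
have: x = inord x by rewrite inord_val.
by case: x => [[|[|[|n]]] ltn] //= ->; rewrite ?s0 ?s1 ?s2.
Qed.

Lemma tracks_advance st v lb : tracks st v -> tracks (advance st lb) (nbr v lb).
Proof.
case: st v => [[[[x y] z] [m n]] i] [[s c] j] [/= E1 -> ->].
case: lb => [b|] //=; case: j; split; rewrite //= ?images_a ?images_b -?E1 //.
  by rewrite rmorphD /= mulrDr addrA; congr (_ + _); rewrite mulrC.
by rewrite rmorphD /= mulr1 addrAC.
Qed.

(** Both kinds of walks follow the same labels in parallel; the last test says that the
    [Z_p]-component of the end vertex is 0. *)
Lemma nb_walks_sym k v lb st i : tracks st (nbr v lb) ->
  nb_walks e k v (nbr v lb) ((1%g, 0), i) =
  count (fun st' => [&& st'.1.1 == (0, 1, 2)%N, st'.2 == i &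
                      (p %| st'.1.2.1 + l%:Z * st'.1.2.2)%Z])
        (sym_walks k lb st).
Proof.
elim: k v lb st => [|k IH] v lb st T.
  rewrite /= addn0; case: (nbr v lb) T => [[s z] j] [/= -> -> ->].
  rewrite images1 !xpair_eqE -Zp_intr0 rmorphD rmorphM /= -lam_nat -andbA.
  by congr (nat_of_bool (_ && _)); rewrite andbC.
rewrite nb_walksS /= count_flatten -map_comp sumnE big_map.
by apply: eq_bigr => lb' _; apply: IH; apply: tracks_advance.
Qed.

Lemma nb_walks_start i lb :
  nb_walks e 9 ((1%g, 0), i) (nbr ((1%g, 0), i) lb) ((1%g, 0), i) =
  ((if p == 5 then 22 else 6) + (lb == None).*2)%N.
Proof.
rewrite (@nb_walks_sym _ _ _ (advance (start i) lb)); last first.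
  apply: tracks_advance; split=> //=; last by rewrite mulr0 addr0.
  by apply/esym/eqP; rewrite images1.
rewrite -(count_returns i) /returns count_map count_filter.
by apply: eq_count => st; rewrite /= [RHS]andbC andbA.
Qed.

(** * Right translations and [alpha] *)

(* Conjugation by aba = bab exchanges a and b. *)
Definition conj_s3 : 'S_3 := (s3a * s3b * s3a)%g.

(** The product of [aba] and [bab] is [(ab)^3 = 1], and [bab] squares to 1. *)
Lemma conj_s3_braid : conj_s3 = (s3b * s3a * s3b)%g.
Proof.
apply: (mulIg (s3b * s3a * s3b)%g); rewrite /conj_s3.
transitivity (1%g : 'S_3).
  by rewrite -s3ab3 !expgS expg0 mulg1 !mulgA.
rewrite !mulgA -(mulgA _ s3b s3b) (gen2 true) mulg1.
by rewrite -(mulgA _ s3a s3a) (gen2 false) mulg1 (gen2 true).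
Qed.

Lemma conj_s3_2 : (conj_s3 * conj_s3 = 1)%g.
Proof.
rewrite /conj_s3 !mulgA -(mulgA _ s3a s3a) (gen2 false) mulg1.
by rewrite -(mulgA _ s3b s3b) (gen2 true) mulg1 (gen2 false).
Qed.

Lemma conj_s3_gen i : (gen i ^ conj_s3 = gen (~~ i))%g.
Proof.
apply: (mulgI conj_s3); rewrite -conjgC.
case: i; rewrite /=.
  rewrite {1}conj_s3_braid /conj_s3 !mulgA (gen2 true) mul1g.
  by rewrite -(mulgA _ s3a s3a) (gen2 false) mulg1.
rewrite {2}conj_s3_braid /conj_s3 !mulgA (gen2 false) mul1g.
by rewrite -(mulgA _ s3b s3b) (gen2 true) mulg1.
Qed.

Definition theta (h : S3Zp p) : S3Zp p :=
  ((h.1 ^ conj_s3)%g, lam * (h.2 : 'Z_p)).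

Lemma thetaM : {morph theta : x y / (x * y)%g}.
Proof.
move=> [s z] [t w]; congr pair; rewrite /= ?conjMg //.
exact: mulrDr.
Qed.

Lemma theta2 h : theta (theta h) = (h.1, - (h.2 : 'Z_p)).
Proof.
by rewrite /theta /= -conjgM conj_s3_2 conjg1 mulrA -expr2 lam2 mulN1r.
Qed.

Lemma theta4 h : theta (theta (theta (theta h))) = h.
Proof. by rewrite !theta2 /= opprK; case: h. Qed.

Definition alpha_fun (v : V) : V := (theta v.1, ~~ v.2).

Lemma alpha_fun4 v : alpha_fun (alpha_fun (alpha_fun (alpha_fun v))) = v.
Proof. by rewrite /alpha_fun /= theta4 !negbK; case: v. Qed.

Lemma alpha_inj : injective alpha_fun.
Proof.
exact: (can_inj (g := alpha_fun \o alpha_fun \o alpha_fun) alpha_fun4).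
Qed.

Definition alpha : {perm V} := perm alpha_inj.

Lemma alpha2E h i : (alpha ^+ 2)%g (h, i) = ((h.1, - (h.2 : 'Z_p)), i).
Proof. by rewrite expgS expg1 permM !permE /alpha_fun /= theta2 negbK. Qed.

Definition rtrans_fun (h : S3Zp p) (v : V) : V := ((v.1 * h)%g, v.2).

Lemma rtrans_inj h : injective (rtrans_fun h).
Proof.
case=> x i [y j] E; have -> : x = y := @mulIg _ h _ _ (congr1 fst E).
by have -> : i = j := congr1 snd E.
Qed.

Definition rtrans (h : S3Zp p) : {perm V} := perm (@rtrans_inj h).

Lemma rtransM : {morph rtrans : x y / (x * y)%g}.
Proof.
by move=> x y; apply/permP => v; rewrite permM !permE /rtrans_fun /= mulgA.
Qed.

Lemma rtransJ h : (rtrans h ^ alpha)%g = rtrans (theta h).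
Proof.
apply: (mulgI alpha); rewrite -conjgC; apply/permP => v.
by rewrite !permM !permE /alpha_fun /rtrans_fun /= thetaM.
Qed.

(** The sign [sg] records on which sides [f] reverses the rims: translations reverse neither,
    [alpha] reverses side 1 because [lambda^2 = -1]. *)
Lemma graph_aut_nbr (f : {perm V}) (sg : bool -> bool) :
  (forall v lb, f (nbr v lb) = nbr (f v) (omap (addb (sg v.2)) lb)) ->
  f \in graph_aut e.
Proof.
move=> fE; apply/graph_autP => v w; apply/edgeP/edgeP => -[lb E].
  exists (omap (addb (sg v.2)) lb); apply: (@perm_inj _ f); rewrite fE E.
  by case: lb {E} => [b|] //=; rewrite addKb.
by exists (omap (addb (sg v.2)) lb); rewrite E fE.
Qed.

Lemma rtrans_aut h : rtrans h \in graph_aut e.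
Proof.
apply: (graph_aut_nbr (sg := fun _ => false)) => -[[s z] i] [b|];
  rewrite !permE //=.
case: h => t w; congr (_, _, _); rewrite ?mulgA //.
by rewrite /= !FinRing.zmodMgE addrAC.
Qed.

Lemma alpha_aut : alpha \in graph_aut e.
Proof.
apply: (graph_aut_nbr (sg := id)) => -[[s z] i] [b|]; rewrite !permE //=.
rewrite /alpha_fun /theta /= conjMg conj_s3_gen; congr (_, _, _).
rewrite mulrDr; congr (_ + _); case: i => /=.
  rewrite mulrCA -expr2 lam2 mulr1 mulrN1.
  by case: b; rewrite /= rmorphN ?opprK.
by rewrite mulr1 mulrC.
Qed.

Definition base (i : bool) : V := ((1%g, 0), i).

Lemma base_orbit (G : {group {perm V}}) (v : V) :
    alpha \in G -> (forall h, rtrans h \in G) ->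
  exists2 g, g \in G & g (base false) = v.
Proof.
move=> Ga Gr; case: v => h [].
  exists (alpha * rtrans h)%g; first by rewrite groupM ?Gr.
  rewrite permM !permE /rtrans_fun /alpha_fun /= /theta /= conj1g mulr0.
  by congr (_, _); apply: mul1g.
by exists (rtrans h); rewrite ?Gr // permE; congr (_, _); apply: mul1g.
Qed.

(** * Automorphisms preserve spokes *)

(** Right translations keep labels and carry [base i] to every vertex of side [i]. *)
Lemma nb_walks_arc v lb :
  nb_walks e 9 v (nbr v lb) v =
  ((if p == 5 then 22 else 6) + (lb == None).*2)%N.
Proof.
case: v => h i; rewrite -(nb_walks_start i lb).
have F : rtrans h (base i) = (h, i).
  by rewrite permE; congr (_, _); apply: mul1g.
rewrite -(nb_walks_aut 9 (base i) (nbr (base i) lb) (base i) (rtrans_aut h)) F.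
congr (nb_walks _ _ _ _ _); rewrite permE /rtrans_fun.
case: lb h {F} => [b|] [s z] /=; congr (_, _, _); rewrite ?mulg1 ?mul1g //.
all: by rewrite FinRing.zmodMgE ?add0r // addrC.
Qed.

Lemma aut_spoke (f : {perm V}) v :
  f \in graph_aut e -> f (nbr v None) = nbr (f v) None.
Proof.
move=> fA; have: e (f v) (f (nbr v None)).
  by move/graph_autP: (fA) => ->; apply/edgeP; exists None.
case/edgeP=> lb E; have := nb_walks_aut 9 v (nbr v None) v fA.
rewrite E !nb_walks_arc => /addnI /=.
by case: lb {E}.
Qed.

Lemma aut_rim (f : {perm V}) v b : f \in graph_aut e ->
  exists b', f (nbr v (Some b)) = nbr (f v) (Some b').
Proof.
move=> fA; have: e (f v) (f (nbr v (Some b))).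
  by move/graph_autP: (fA) => ->; apply/edgeP; exists (Some b).
case/edgeP=> [[b'|] E]; first by exists b'.
have := nb_walks_aut 9 v (nbr v (Some b)) v fA.
by rewrite E !nb_walks_arc => /addnI.
Qed.

(** * Induction over the vertices and connectedness *)

(** Two steps in the same direction cancel the involution [gen i] and shift [z] by twice the stride,
    which generates [Z_p] since [p] is odd. *)
Lemma rim_shift (P : V -> Prop) :
    (forall v b, P v -> P (nbr v (Some b))) ->
  forall s z z' i, P ((s, z), i) -> P ((s, z'), i).
Proof.
move=> PS s z z' i Pz.
have Pk k : P ((s, z + k%:R * (2%:R * stride i)), i).
  elim: k => [|k IH]; first by rewrite mul0r addr0.
  move: (PS _ false (PS _ false IH)); rewrite /= mulgA gen2 mul1g.
  congr (P ((_, _), _)); rewrite -!addrA; congr (_ + _).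
  by rewrite -[k.+1%:R]natr1 !mulrDl !mul1r.
have U : 2%:R * stride i \is a GRing.unit.
  rewrite unitrMl ?stride_unit // unitZpE // prime_coprime //.
  by rewrite gtnNdvd // (leq_trans _ p_ge5).
have := Pk ((z' - z) / (2%:R * stride i) : 'Z_p).
by rewrite natr_Zp divrK // addrC subrK.
Qed.

(** Induction on a word in [a] and [b] for the [S_3]-component; the [Z_p]-component can be adjusted
    freely by [rim_shift]. *)
Lemma vertex_ind (P : V -> Prop) :
    (forall v lb, P v -> P (nbr v lb)) -> P (base false) -> forall v, P v.
Proof.
move=> PS P0 v.
have shift := rim_shift (fun v b => PS v (Some b)).
suff all_s : forall s z i, P ((s, z), i) by case: v => [[s z] i].
move=> s.
have: s \in <<[set s3a; s3b]>>%g by rewrite gen_s3ab inE.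
case/gen_prodgP=> n [c cE ->].
elim: n c cE => [|n IH] c cE z i.
  have P1 : P ((1%g, z), false) by apply: shift P0.
  by rewrite big_ord0; case: i => //; apply: (PS _ None P1).
rewrite big_ord_recl; set t := (\prod_(_ < _) _)%g.
have Pt j : P ((t, z), j) by apply: IH.
have [j ->] : exists j, c ord0 = gen j.
  by have := cE ord0; rewrite !inE => /orP[] /eqP->; [exists false|exists true].
(* A rim step on side [j] multiplies by [gen j], and the shift restores [z]; a spoke then changes
   the side if [i] differs from [j]. *)
have Pj : P (((gen j * t)%g, z), j) := shift _ _ _ _ (PS _ (Some false) (Pt j)).
case: (eqVneq i j) => [->|] //; rewrite -addbT.
by have := PS _ None Pj => /=; case: i j {Pj Pt} => [] [].
Qed.

Lemma NC9_connected : connected_graph e.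
Proof.
have C v : connect e (base false) v.
  elim/vertex_ind: v => [v lb C|]; last exact: connect0.
  by apply: connect_trans C _; apply/connect1/edgeP; exists lb.
move=> x y; apply: connect_trans (C y).
by rewrite (sym_connect_sym (proj1 (NC9_simple lambda))).
Qed.

Lemma nbr_inj v : injective (nbr v).
Proof.
have /= := nbr_uniq v; rewrite !inE !negb_or andbT => /andP[/andP[n1 n2] n3].
by case=> [[]|] [[]|] // /eqP; rewrite ?(negbTE n1) ?(negbTE n2) ?(negbTE n3) //
  eq_sym ?(negbTE n1) ?(negbTE n2) ?(negbTE n3).
Qed.

(** * Rigidity of automorphisms *)

Section Rigidity.

Variable f : {perm V}.
Hypothesis fA : f \in graph_aut e.

Definition fixes_star (v : V) := f v = v /\ forall lb, f (nbr v lb) = nbr v lb.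

(** The spoke goes to a spoke, and the other rim neighbour has only its own place left. *)
Lemma fixes_star_rim v b :
  f v = v -> f (nbr v (Some b)) = nbr v (Some b) -> fixes_star v.
Proof.
move=> fv fb; split=> // -[c|]; last by rewrite aut_spoke ?fv.
have [->//|ncb] := eqVneq c b.
have [b' E] := aut_rim v c fA; rewrite fv in E; rewrite E.
suff nb : b' != b.
  by congr (nbr v (Some _)); case: b' b c ncb nb {E fb} => [] [] [].
apply: contra_neq ncb => Eb; rewrite Eb -fb in E.
by have /nbr_inj[] := perm_inj E.
Qed.

Lemma fixes_star_nbr v lb : fixes_star v -> fixes_star (nbr v lb).
Proof.
have rim w b : fixes_star w -> fixes_star (nbr w (Some b)).
  case=> fw fnb; apply: (@fixes_star_rim _ (~~ b)); rewrite ?fnb //.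
  by have := nbrK w (Some b) => /= ->.
case: lb => [b|]; first exact: rim.
case: v => [[s z] i] F.
(* The rim step case fixes the stars of all [((s, z'), i)], hence also the far ends of their
   spokes. *)
have Fz z' : f ((s, z'), ~~ i) = ((s, z'), ~~ i).
  by have [_ /(_ None)] := rim_shift rim z' F.
rewrite /=; set y := ((s, z), ~~ i); set j := ~~ i in Fz y *.
apply: (@fixes_star_rim _ false); rewrite ?Fz //.
have [b E] := aut_rim y false fA.
(* The vertices y and y2 are fixed and two steps apart on a rim cycle, so their
   only common neighbour is fixed as well. *)
set y2 : V := ((s, z + 2%:R * stride j), j).
have y2E : nbr y2 (Some true) = nbr y (Some false).
  by rewrite /= -addrA mulN1r mulr2n mulrDl mul1r addrK.
have [b' E'] := aut_rim y2 true fA.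
(* If this neighbour went to the other side of [y], then 2 or 4 times the stride would vanish,
   according to the direction [b'] at [y2]. *)
move: E'; rewrite y2E E !Fz; case: b {E} => //=.
move=> /(congr1 (fun v : V => (v.1.2 : 'Z_p))) /=.
rewrite -addrA => /addrI /eqP; rewrite mulN1r eq_sym -[_ == _]addr_eq0.
have -> : 2%:R * stride j + (sgn b')%:~R * stride j + stride j =
          (if b' then 2 else 4)%:R * stride j by case: b'; rewrite /=; ring.
by rewrite natr_stride_eq0 //; case: b'.
Qed.

Lemma fixes_star_id : fixes_star (base false) -> f = 1%g.
Proof.
move=> F; apply/permP => v; rewrite perm1.
suff [] : fixes_star v by [].
by elim/vertex_ind: v => // v lb; apply: fixes_star_nbr.
Qed.

End Rigidity.

(** * The stabiliser of a vertex and regular subgroups *)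

Lemma alpha4 : (alpha ^+ 4 = 1)%g.
Proof.
by apply/permP => v; rewrite !expgS expg0 mulg1 !permM !permE alpha_fun4.
Qed.

Lemma stab_base f : f \in graph_aut e -> f (base false) = base false ->
  f = 1%g \/ f = (alpha ^+ 2)%g.
Proof.
move=> fA f0; have [b E] := aut_rim (base false) false fA; rewrite f0 in E.
case: b E => E; last first.
  by left; apply: fixes_star_id => //; apply: fixes_star_rim E.
right; have a2A : (alpha ^+ 2)%g \in graph_aut e by rewrite groupX ?alpha_aut.
(* Both [f] and [alpha^2] swap the two rim neighbours of the base vertex, so their product fixes its
   star. *)
suff E1 : (f * alpha ^+ 2 = 1)%g.
  by apply: (mulIg (alpha ^+ 2)%g); rewrite E1 -expgD alpha4.
have gA := groupM fA a2A; apply: (fixes_star_id gA).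
apply: (fixes_star_rim (b := false) gA).
  by rewrite permM f0 alpha2E /= oppr0.
by rewrite permM E alpha2E /= !add0r mulN1r opprK mul1r.
Qed.

Lemma alpha2_neq1 : (alpha ^+ 2 != 1)%g.
Proof.
apply/eqP => /permP/(_ ((1%g, 1), false)); rewrite perm1 alpha2E.
move/(congr1 (fun v : V => (v.1.2 : 'Z_p)))/eqP; rewrite /= eq_sym -addr_eq0.
by have := @natr_stride_eq0 2 false isT; rewrite mulr1 mulr2n => ->.
Qed.

Lemma order_alpha : #[alpha]%g = 4.
Proof.
have := order_dvdn alpha 2; rewrite (negbTE alpha2_neq1).
have : (#[alpha]%g %| 2 ^ 2)%N by rewrite order_dvdn alpha4.
by case/(dvdn_pfactor _ _ (isT : prime 2)) => [[|[|[|m]]]] // _ ->;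
   rewrite ?dvd1n ?dvdnn.
Qed.

Lemma NC9_not_Cayley : ~ is_Cayley e.
Proof.
case=> G GA [tr reg].
have [g gG gE] : exists2 g, g \in G & g (base false) = alpha (base false).
  have := atransP2 tr (in_setT (base false)) (in_setT (alpha (base false))).
  by case=> g gG ->; exists g.
have a2G : (alpha ^+ 2)%g \in G.
  have [||E|E] := @stab_base (g * alpha^-1)%g.
  - by rewrite groupM ?groupV ?alpha_aut // (subsetP GA).
  - by rewrite permM gE permK.
  - by rewrite (_ : alpha = g) ?groupX //; apply/esym/eqP; rewrite eq_mulgV1 E.
  (* Here [g = alpha^3], whose square is [alpha^6 = alpha^2]. *)
  - have -> : (alpha ^+ 2 = g ^+ 2)%g; last exact: groupX.
    have -> : g = (alpha ^+ 3)%g by rewrite expgSr -E mulgKV.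
    by rewrite -expgM (expgD _ 4 2) alpha4 mul1g.
case/eqP: alpha2_neq1; apply/set1gP; rewrite -(reg (base false)).
rewrite inE a2G /= ; apply/astab1P; rewrite /= /aperm alpha2E /= oppr0 //.
Qed.

(** * Valency and transitivity *)

Lemma NC9_cubic : cubic e.
Proof.
move=> v; have -> : [set w | e v w] = nbr v @: [set: label].
  apply/setP => w; rewrite inE.
  by apply/edgeP/imsetP => -[lb]; [exists lb | move=> _; exists lb].
by rewrite card_imset ?cardsT ?card_option ?card_bool //; apply: nbr_inj.
Qed.

Lemma NC9_vertex_transitive : vertex_transitive e.
Proof.
apply/imsetP; exists (base false); first by rewrite inE.
apply/setP => v; rewrite inE; apply/esym/imsetP.
by have [g gA <-] := base_orbit v alpha_aut rtrans_aut; exists g.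
Qed.

Lemma NC9_not_arc_transitive : ~ arc_transitive e.
Proof.
move=> T; have edge lb : e (base false) (nbr (base false) lb).
  by apply/edgeP; exists lb.
have [f fA [f0]] := T _ _ _ _ (edge None) (edge (Some false)).
by rewrite aut_spoke // f0 => /nbr_inj.
Qed.

(** * The automorphism group as a semidirect product *)

Definition theta_iter (h : S3Zp p) (k : 'Z_4) : S3Zp p := iter k theta h.

Lemma iter_mod4 (T : Type) (g : T -> T) n x :
  (forall y, iter 4 g y = y) -> iter (n %% 4) g x = iter n g x.
Proof.
move=> g4; rewrite [in RHS](divn_eq n 4) iterD iterM.
by move: (iter _ g x) => y; elim: (n %/ 4)%N => // q IH; rewrite iterS -IH g4.
Qed.

Lemma theta_is_action : is_action [set: 'Z_4] theta_iter.
Proof.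
have E h (a b : 'Z_4) : theta_iter h (a * b)%g = theta_iter (theta_iter h a) b.
  transitivity (iter ((b + a) %% 4)%N theta h); first by rewrite addnC.
  by rewrite iter_mod4 ?iterD //; apply: theta4.
split=> [k h h' /(congr1 (theta_iter^~ k^-1%g))|h a b _ _]; last exact: E.
by rewrite -!E mulgV.
Qed.

Canonical theta_action := Action theta_is_action.

Lemma theta_iterM k : {morph theta_iter^~ k : x y / (x * y)%g}.
Proof.
by rewrite /theta_iter => x y; elim: (nat_of_ord k) => //= n ->; apply: thetaM.
Qed.

Lemma theta_is_groupAction : is_groupAction [set: S3Zp p] theta_action.
Proof.
move=> k _; rewrite inE; apply/andP; split.
  by apply/subsetP => x; rewrite inE.
by apply/morphicP => x y _ _; rewrite !actpermE; apply: theta_iterM.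
Qed.

Definition theta_groupAction := GroupAction theta_is_groupAction.

Definition rtrans_morphism :=
  @Morphism _ _ [set: S3Zp p] rtrans (in2W rtransM).

Lemma alphaX_morph :
  {in [set: 'Z_4] &, {morph (fun k : 'Z_4 => alpha ^+ k)%g : x y / (x * y)%g}}.
Proof.
by move=> x y _ _ /=; rewrite -expgD (expg_mod _ alpha4).
Qed.

Definition alphaX_morphism := @Morphism _ _ [set: 'Z_4] _ alphaX_morph.

(** Conjugation by [alpha] induces [theta] on translations; this compatibility glues the two
    embeddings into a morphism on the semidirect product. *)
Lemma rtrans_act : {in [set: S3Zp p] & [set: 'Z_4],
  morph_act theta_groupAction 'J rtrans_morphism alphaX_morphism}.
Proof.
move=> h k _ _ /=; rewrite /theta_iter; elim: (nat_of_ord k) => [|n IH].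
  by rewrite expg0 conjg1.
by rewrite iterS -rtransJ IH expgSr conjgM.
Qed.

(** Some automorphism [g] in [G] agrees with [f] at the base vertex, so [g * f^-1] is 1 or
    [alpha^2], and both lie in [G]. *)
Lemma aut_sub_gen (G : {group {perm V}}) :
  alpha \in G -> (forall h, rtrans h \in G) -> graph_aut e \subset G.
Proof.
move=> Ga Gr; apply/subsetP => f fA.
have [||g /setIP[gG gA] gE] :=
  base_orbit (G := (G :&: graph_aut_group e)%G) (f (base false)).
- by rewrite inE Ga alpha_aut.
- by move=> h; rewrite inE Gr rtrans_aut.
have [||E|E] := @stab_base (g * f^-1)%g.
- by rewrite groupM ?groupV.
- by rewrite permM gE permK.
- by rewrite -groupV -(groupMl _ gG) E group1.
- by rewrite -groupV -(groupMl _ gG) E groupX.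
Qed.

Lemma aut_isog :
  graph_aut e \isog [set: sdprod_by theta_groupAction].
Proof.
rewrite isog_sym; apply/isogP.
exists [morphism of xsdprodm rtrans_act].
  rewrite injm_xsdprodm; apply/and3P; split.
  - apply/injmP => h h' _ _ /= /permP/(_ (base false)).
    rewrite !permE => /(congr1 fst).
    by apply: mulgI.
  - apply/injmP => k k' _ _ /= /eqP; rewrite eq_expg_mod_order order_alpha.
    by rewrite !modn_small ?ltn_ord // => /eqP/val_inj.
  (* Powers of [alpha] keep the group component of the base vertex trivial, whereas [rtrans h] turns
     it into [h]. *)
  apply/eqP/trivgP/subsetP => _ /setIP[/morphimP[h _ _ ->]].
  case/morphimP => k _ _ /= E.
  have {}E : (rtrans h (base false)).1 = 1%g.
    rewrite E; elim: (nat_of_ord k) => [|n IH]; first by rewrite perm1.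
    by rewrite expgSr permM permE /= IH /theta /= conj1g mulr0.
  have -> : h = 1%g by rewrite -E permE /= mul1g.
  by rewrite inE; apply/eqP; apply: (morph1 rtrans_morphism).
set G := [group of
  (xsdprodm rtrans_act @* [set: sdprod_by theta_groupAction])%g].
have imE : (G = rtrans_morphism @* [set: S3Zp p] *
                alphaX_morphism @* [set: 'Z_4] :> {set {perm V}})%g.
  exact: im_xsdprodm.
suff GE : G = graph_aut e :> {set {perm V}} by exact: GE.
move: (G) imE => {}G imE; apply/eqP; rewrite eqEsubset; apply/andP; split.
  rewrite imE mul_subG //; apply/subsetP => _ /morphimP[h _ _ ->].
    exact: rtrans_aut.
  by rewrite groupX ?alpha_aut.
apply: aut_sub_gen => [|h]; rewrite imE.
  rewrite -[alpha]mul1g mem_mulg ?group1 //.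
  have -> : alpha = alphaX_morphism (1%R : 'Z_4) by rewrite /= expg1.
  by rewrite mem_morphim ?inE.
rewrite -[rtrans h]mulg1 mem_mulg ?group1 //.
by rewrite (mem_morphim rtrans_morphism) ?inE.
Qed.

End Graph.

Local Close Scope ring_scope.
Unset Implicit Arguments.

Theorem theorem5p4 (p : nat) (p_prime : prime p) (p_mod4 : p = 1 %[mod 4])
    (lambda : {unit 'Z_p}) (lambda_order : #[lambda]%g = 4) :
  [/\ simple_graph (NC9 lambda) /\ connected_graph (NC9 lambda),
      cubic (NC9 lambda),
      ~ arc_transitive (NC9 lambda) /\ vertex_transitive (NC9 lambda),
      ~ is_Cayley (NC9 lambda) &
      #|{: S3Zp p * bool}| = (12 * p)%N] /\
  exists to : groupAction [set: 'Z_4] [set: S3Zp p],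
    graph_aut (NC9 lambda) \isog [set: sdprod_by to].
Proof.
split; last by exists (theta_groupAction p_prime lambda_order); apply: aut_isog.
split.
- by split; [apply: NC9_simple | apply: NC9_connected].
- exact: NC9_cubic.
- split; [exact: NC9_not_arc_transitive | exact: NC9_vertex_transitive].
- exact: NC9_not_Cayley.
by rewrite card_prod card_S3Zp ?prime_gt1 // card_bool mulnAC.
Qed.
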